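(* Let $k$ be a field of characteristic zero. Any finite-dimensional Lie algebra $\mathfrak{g}$ over $k$ admitting a Novikov structure is solvable.
   Context: An affine structure on a Lie algebra $\mathfrak{g}$ over $k$ is a $k$-bilinear product $\mathfrak{g}\times\mathfrak{g}\to\mathfrak{g}$, $(x,y)\mapsto x\cdot y$, which is left-symmetric, i.e. $x\cdot(y\cdot z)-(x\cdot y)\cdot z=y\cdot(x\cdot z)-(y\cdot x)\cdot z$ for all $x,y,z\in\mathfrak{g}$, and which satisfies $[x,y]=x\cdot y-y\cdot x$ for all $x,y\in\mathfrak{g}$. A Novikov structure on $\mathfrak{g}$ is an affine structure whose product satisfies in addition $(x\cdot y)\cdot z=(x\cdot z)\cdot y$ for all $x,y,z\in\mathfrak{g}$. *)

(* Defs.v *)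
From HB Require Import structures.
From mathcomp Require Import all_boot all_order all_algebra.

Set Implicit Arguments.
Unset Strict Implicit.
Unset Printing Implicit Defensive.

Import GRing.Theory.
Local Open Scope ring_scope.

Section LieAlgebra.

Variables (k : fieldType) (g : vectType k).
Implicit Types (br dot : {bilinear g -> g -> g}) (U V W : {vspace g}).

Record is_lie_bracket br : Prop := IsLieBracket {
  lie_alternating : forall x, br x x = 0;
  lie_jacobi : forall x y z, br x (br y z) + br y (br z x) + br z (br x y) = 0
}.

(* The subspace [U, V] is spanned by all brackets of elements of U with
   elements of V; brackets of basis vectors suffice (see lie_commP). *)
Definition lie_comm br U V : {vspace g} :=
  <<[seq br u v | u <- vbasis U, v <- vbasis V]>>%VS.

Lemma mem_lie_comm br U V u v :
  u \in U -> v \in V -> br u v \in lie_comm br U V.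
Proof.
move=> Uu Vv; rewrite (coord_vbasis Uu) (coord_vbasis Vv).
rewrite linear_sumlz /= memv_suml // => i _.
rewrite linear_sumr /= memv_suml // => j _.
rewrite linearZl_LR linearZr_LR /= !memvZ // memv_span //.
by apply: allpairs_f; rewrite mem_nth // size_tuple.
Qed.

Lemma lie_commP br U V W :
  reflect (forall u v, u \in U -> v \in V -> br u v \in W)
          (lie_comm br U V <= W)%VS.
Proof.
apply: (iffP idP) => [sUVW u v Uu Vv | sUVW].
  exact/(subvP sUVW)/mem_lie_comm.
apply/span_subvP=> _ /allpairsP[[u v] /= [Uu Vv ->]].
by apply: sUVW; apply: vbasis_mem.
Qed.

Definition derived_series br (n : nat) : {vspace g} :=
  iter n (fun U => lie_comm br U U) fullv.

Definition lie_solvable br : Prop := exists n, derived_series br n = 0%VS.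

Record is_affine_structure br dot : Prop := IsAffineStructure {
  affine_left_symmetric : forall x y z,
    dot x (dot y z) - dot (dot x y) z = dot y (dot x z) - dot (dot y x) z;
  affine_bracket : forall x y, br x y = dot x y - dot y x
}.

Record is_novikov_structure br dot : Prop := IsNovikovStructure {
  novikov_affine : is_affine_structure br dot;
  novikov_right_comm : forall x y z, dot (dot x y) z = dot (dot x z) y
}.

End LieAlgebra.

(* Main.v *)
Require Import Defs.
From HB Require Import structures.
From mathcomp Require Import all_boot all_order all_algebra.

Set Implicit Arguments.
Unset Strict Implicit.
Unset Printing Implicit Defensive.

Import GRing.Theory VectorInternalTheory.
Local Open Scope ring_scope.

(** Let L_x and R_x be the left and right multiplications of the Novikov
    product.  The Novikov identity says that the R_x commute with each other;
    left symmetry, read as an identity of operators, says that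
      [L_x, R_y] = R_{x.y} - R_y R_x.
    Hence [L_x, R_y] is a polynomial in right multiplications and so commutes
    with R_y.  In characteristic zero a commutator [a, b] that commutes with b
    is nilpotent as soon as b is algebraic (Jacobson, [jacobson_nilpotent]).
    The difference of [L_x, R_y] and [L_y, R_x] is R_{[x,y]}, and the two
    commute, so every R_{[x,y]} is nilpotent ([right_mx_br_nilpotent]).

    Thus W = [g, g] is spanned by finitely many elements whose right
    multiplications are nilpotent and commute, and every product of sufficiently
    many of these operators vanishes ([prod_commuting_nilpotents]).  On the
    other hand each term of the derived series from W on lies in W, so that
    a bracket u.v - v.u of two elements of such a term D lies in the sum of the
    images of D under the right multiplications by elements of W.  Therefore the
    term of index n + 1 lies in the sum of the images of products of n of them
    ([derived_series_annihilated]), which is 0 for n large. *)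

(** * Commuting nilpotent elements *)

Section Nilpotent.

Variable R : pzRingType.
Implicit Types (x y : R) (s t : seq R).

Definition nilpotent_elt x := exists n, x ^+ n = 0.

Lemma expr_eq0_leq x m n : (m <= n)%N -> x ^+ m = 0 -> x ^+ n = 0.
Proof. by move=> le_mn x0; rewrite -(subnKC le_mn) exprD x0 mul0r. Qed.

Lemma nilpotent_eltB x y :
  GRing.comm x y -> nilpotent_elt x -> nilpotent_elt y -> nilpotent_elt (x - y).
Proof.
move=> cxy [m xm] [n yn]; exists (m + n)%N.
rewrite (exprDn_comm _ (commrN cxy)) big1 // => i _.
have [le_ni | lt_in] := leqP n i.
  by rewrite [(- y) ^+ i]exprNn (expr_eq0_leq _ yn) // !mulr0 mul0rn.
by rewrite (expr_eq0_leq _ xm) ?mul0r ?mul0rn // -addnBA ?leq_addr // ltnW.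
Qed.

Lemma prod_collect x t : {in t, forall y, GRing.comm x y} ->
  \prod_(y <- t) y = x ^+ count_mem x t * \prod_(y <- t | y != x) y.
Proof.
elim: t => [|y t IHt] cxt; first by rewrite !big_nil mulr1.
rewrite !big_cons IHt => [|z tz]; last by apply: cxt; rewrite inE tz orbT.
rewrite /=; case: eqP => [-> | _]; first by rewrite exprS mulrA.
have cyx : GRing.comm y x by apply/commr_sym/cxt; rewrite mem_head.
by rewrite add0n !mulrA (commrX _ cyx).
Qed.

(** If [a ^+ m = 0], a word in which [a] occurs at least [m] times vanishes;
    a long word in which it occurs less often contains a long word in the other
    elements, to which induction on the list applies. *)
Lemma prod_commuting_nilpotents s :
    {in s &, forall x y, GRing.comm x y} -> {in s, forall x, nilpotent_elt x} ->
  exists n, forall t, {subset t <= s} -> (n <= size t)%N -> \prod_(x <- t) x = 0.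
Proof.
elim: s => [|a s IHs] cs nils.
  exists 1%N => -[|x t] // /(_ x); rewrite mem_head => /(_ isT).
  by rewrite in_nil.
have [|m a0] := nils a; first exact: mem_head.
have [x y sx sy|x sx|n prod0] := IHs.
- by apply: cs; rewrite inE ?sx ?sy orbT.
- by apply: nils; rewrite inE sx orbT.
exists (m + n)%N => t sts le_mn_t.
rewrite (@prod_collect a) => [|y /sts]; last by apply: cs; rewrite mem_head.
have [le_m | lt_m] := leqP m (count_mem a t).
  by rewrite (expr_eq0_leq _ a0) ?mul0r.
rewrite -big_filter prod0 ?mulr0 // => [x|].
  by rewrite mem_filter => /andP[/negPf xa /sts]; rewrite inE xa.
rewrite size_filter -(leq_add2l (count_mem a t)) (count_predC (pred1 a) t).
by rewrite (leq_trans _ le_mn_t) ?leq_add2r // ltnW.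
Qed.

End Nilpotent.

(** * Jacobson's lemma on nilpotent commutators *)

Section Jacobson.

Variables (k : fieldType) (A : algType k).

Lemma comm_horner_alg (a b : A) (p : {poly k}) :
  GRing.comm a b -> GRing.comm a (horner_alg b p).
Proof.
move=> cab; elim/poly_ind: p => [|p l IHp]; first by rewrite rmorph0; apply: commr0.
rewrite rmorphD rmorphM /= horner_algX horner_algC.
by apply: commrD; [apply: commrM | apply/commr_sym/comm_alg].
Qed.

(** The map [a, -] is a derivation, and on the algebra generated by [b] the
    derivation with value [c] at [b] is [c] times the formal derivative, because
    [c] commutes with [b]. *)
Lemma commutator_horner (a b : A) (p : {poly k}) :
    GRing.comm (a * b - b * a) b ->
  a * horner_alg b p - horner_alg b p * a
    = (a * b - b * a) * horner_alg b p^`().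
Proof.
set c := a * b - b * a => ccb.
elim/poly_ind: p => [|p l IHp]; first by rewrite deriv0 rmorph0 !mulr0 mul0r subrr.
rewrite derivMXaddC !(rmorphD, rmorphM) /= horner_algX horner_algC.
set P := horner_alg b p in IHp *; set Q := horner_alg b _ in IHp *.
have cP : c * P = P * c by apply: comm_horner_alg.
rewrite !mulrDr [c * (Q * b)]mulrA -IHp cP mulrDl comm_alg.
rewrite opprD addrACA subrr addr0 mulrBl mulrBr !mulrA.
by rewrite [RHS]addrC addrA subrK.
Qed.

Hypothesis k_char0 : [pchar k] =i pred0.

Lemma size_deriv_pchar0 (p : {poly k}) : size p^`() = (size p).-1.
Proof.
have [->|p0] := eqVneq p 0; first by rewrite deriv0 size_poly0.
have [p1|p1] := leqP (size p) 1.
  by rewrite (size1_polyC p1) derivC size_poly0 size_polyC; case: eqP.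
apply/eqP; rewrite eqn_leq -ltnS prednK ?(ltnW p1) // lt_size_deriv //=.
case: (size p) p1 (lead_coefE p) => [|[|n]] //= _ lp.
rewrite ltnNge; apply/negP => le_n.
have := nth_default 0 le_n; rewrite coef_deriv => /eqP.
by rewrite -mulr_natr mulf_eq0 -lp lead_coef_eq0 (negPf p0) (pcharf0P _).1.
Qed.

(** Write [c] for the commutator.  A relation c^m p(b) = 0 implies
    c^(2m+1) p'(b) = c^m [a, p(b)] c^m = 0.  Differentiating until [p] becomes a
    nonzero constant leaves a power of [c] equal to 0; characteristic zero
    prevents [p] from becoming 0 earlier. *)
Lemma jacobson_nilpotent (a b : A) (p : {poly k}) :
    p != 0 -> horner_alg b p = 0 -> GRing.comm (a * b - b * a) b ->
  nilpotent_elt (a * b - b * a).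
Proof.
set c := a * b - b * a => p0 pb0 ccb.
have : exists m, c ^+ m * horner_alg b p = 0 by exists 0; rewrite pb0 mulr0.
have [n] := ubnP (size p); elim: n p p0 {pb0} => // n IHn p p0 le_pn [m cmp].
have [p1|p1] := leqP (size p) 1.
  have := cmp; rewrite (size1_polyC p1) horner_algC mulr_algr.
  move=> /(congr1 ( *:%R (p`_0)^-1)).
  rewrite scalerA scaler0 mulVf ?scale1r; first by exists m.
  by apply: contraNneq p0 => e; rewrite (size1_polyC p1) e.
have sp' := size_deriv_pchar0 p.
apply: (IHn p^`()).
- by rewrite -size_poly_eq0 sp' -lt0n -ltnS prednK // ltnW.
- by rewrite sp' -ltnS prednK // ltnW.
exists (m.+1 + m)%N.
have cmP q : c ^+ m * horner_alg b q = horner_alg b q * c ^+ m.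
  by apply/commr_sym/commrX/commr_sym/comm_horner_alg.
rewrite exprD -mulrA cmP exprSr -!mulrA [c * _]mulrA -commutator_horner //.
rewrite mulrBl mulrBr -!mulrA -cmP cmp !mulr0.
by rewrite [c ^+ m * (horner_alg _ _ * _)]mulrA cmp mul0r subr0.
Qed.

End Jacobson.

Lemma jacobson_nilpotent_mx (k : fieldType) (k_char0 : [pchar k] =i pred0)
    n (a b : 'M[k]_n) :
  GRing.comm (a * b - b * a) b -> nilpotent_elt (a * b - b * a).
Proof.
case: n a b => [|n] a b ccb; first by exists 0; apply: flatmx0.
apply: (@jacobson_nilpotent k _ k_char0 a b (char_poly b)) => //.
  exact/monic_neq0/char_poly_monic.
rewrite -[RHS](Cayley_Hamilton b) [RHS](poly_alg_initial (horner_mx b)).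
by rewrite /= horner_mx_X.
Qed.

(** * Novikov structures *)

Section Novikov.

Variables (k : fieldType) (k_char0 : [pchar k] =i pred0) (g : vectType k).
Variables (br dot : {bilinear g -> g -> g}).
Hypothesis novikov : is_novikov_structure br dot.

(** Matrices act on row vectors from the right, so a product of matrices
    stands for the composition in the opposite order. *)
Definition left_mx x := lin1_mx (v2r \o dot x \o r2v).
Definition right_mx x := lin1_mx (v2r \o applyr dot x \o r2v).

Lemma v2r_left_mx x y : v2r y *m left_mx x = v2r (dot x y).
Proof. by rewrite mul_rV_lin1 /= v2rK. Qed.

Lemma v2r_right_mx x y : v2r y *m right_mx x = v2r (dot y x).
Proof. by rewrite mul_rV_lin1 /= v2rK. Qed.

Lemma mx_eq_v2r m (B C : 'M[k]_(dim g, m)) :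
  (forall x : g, v2r x *m B = v2r x *m C) -> B = C.
Proof. by move=> eqBC; apply/row_matrixP => i; rewrite !rowE -[delta_mx _ _]r2vK. Qed.

Lemma right_mx_is_linear : linear right_mx.
Proof.
move=> c x y; apply: mx_eq_v2r => z.
by rewrite mulmxDr -scalemxAr !v2r_right_mx linearPr /= linearP.
Qed.

HB.instance Definition _ :=
  GRing.isLinear.Build k g 'M[k]_(dim g) _ right_mx right_mx_is_linear.

Lemma right_mx_comm x y : GRing.comm (right_mx x) (right_mx y).
Proof.
apply: mx_eq_v2r => z.
by rewrite !mulmxA !v2r_right_mx (novikov_right_comm novikov).
Qed.

Lemma commutator_right_left x y :
  right_mx y * left_mx x - left_mx x * right_mx y
    = right_mx (dot x y) - right_mx x * right_mx y.
Proof.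
apply: mx_eq_v2r => z; rewrite !mulmxBr !mulmxA.
rewrite !(v2r_left_mx, v2r_right_mx) -!linearB /=.
by rewrite (affine_left_symmetric (novikov_affine novikov)).
Qed.

(** [right_mx (br x y)] is the difference of the two commutators attached to
    (x, y) and (y, x): their terms quadratic in right multiplications cancel. *)
Lemma right_mx_br_nilpotent x y : nilpotent_elt (right_mx (br x y)).
Proof.
pose d x y := right_mx (dot x y) - right_mx x * right_mx y.
have comm_d u v z : GRing.comm (d u v) (right_mx z).
  apply/commr_sym/commrB; first exact: right_mx_comm.
  by apply: commrM; apply: right_mx_comm.
have nil_d u v : nilpotent_elt (d u v).
  (* The sign turns the commutator [R_v, L_u] into one with R_v on the right. *)
  have := @jacobson_nilpotent_mx k k_char0 _ (- left_mx u) (right_mx v).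
  rewrite mulNr mulrN opprK addrC commutator_right_left; apply; exact: comm_d.
have -> : right_mx (br x y) = d x y - d y x.
  rewrite (affine_bracket (novikov_affine novikov)) linearB /= /d opprB addrA.
  by rewrite [right_mx x * _]right_mx_comm subrK.
apply: nilpotent_eltB => //; apply: commrB; first exact: comm_d.
by apply: commrM; apply: comm_d.
Qed.

Lemma derived_series_sub1 n :
  (derived_series br n.+1 <= derived_series br 1)%VS.
Proof.
by apply/lie_commP => u v _ _; apply: mem_lie_comm (memvf u) (memvf v).
Qed.

(** The matrix [C] makes the induction go through: for [u.v] in place of [u]
    the factor [right_mx v] is absorbed into [C], and expanding [v] over [s]
    reduces the hypothesis on words of length [n.+1] to words of length [n]. *)
Lemma derived_series_annihilated (s : seq g) n p (C : 'M[k]_(dim g, p)) :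
    derived_series br 1 = <<s>>%VS ->
    (forall t : seq 'M[k]_(dim g), {subset t <= map right_mx s} -> size t = n ->
       (\prod_(x <- t) x) *m C = 0) ->
  forall u, u \in derived_series br n.+1 -> v2r u *m C = 0.
Proof.
move=> Ds; elim: n C => [|n IHn] C tC u.
  by have := tC [::]; rewrite big_nil mul1mx => ->; rewrite ?mulmx0.
pose K := lker (linfun (mulmxr C \o v2r)).
have inK w : (w \in K) = (v2r w *m C == 0) by rewrite memv_ker lfunE.
suff dotK a b : a \in derived_series br n.+1 -> b \in derived_series br n.+1 ->
    dot a b \in K.
  move=> Du; apply/eqP; rewrite -inK; apply: subvP Du.
  apply/lie_commP => a b Da Db.
  by rewrite (affine_bracket (novikov_affine novikov)) rpredB ?dotK.
move=> Da /(subvP (derived_series_sub1 n)); rewrite Ds => sb.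
rewrite (coord_span (X := in_tuple s) sb) linear_sumr.
apply: rpred_sum => i _; rewrite linearZr_LR rpredZ //.
rewrite inK -v2r_right_mx -mulmxA; apply/eqP/IHn => // t sts st.
have := tC (t ++ [:: right_mx s`_i]); rewrite big_cat big_seq1 -mulmxA.
apply; last by rewrite size_cat /= st addn1.
move=> x; rewrite mem_cat => /orP[/sts //|]; rewrite inE => /eqP ->.
by rewrite map_f // mem_nth.
Qed.

Lemma novikov_lie_solvable : lie_solvable br.
Proof.
pose s := [seq br u v | u <- vbasis {:g}, v <- vbasis {:g}].
have [||n prod0] := @prod_commuting_nilpotents _ (map right_mx s).
- by move=> _ _ /mapP[x _ ->] /mapP[y _ ->]; apply: right_mx_comm.
- move=> _ /mapP[_ /allpairsP[[x y] [_ _ ->]] ->].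
  exact: right_mx_br_nilpotent.
exists n.+1; apply/eqP; rewrite -subv0; apply/subvP => u Du.
rewrite memv0; apply/eqP/v2r_inj; rewrite linear0 -[LHS]mulmx1.
apply: (@derived_series_annihilated s n _ 1%:M) Du => // t sts st.
by rewrite prod0 ?mul0mx // st.
Qed.

End Novikov.

Theorem proposition2p4 (k : fieldType) (k_char0 : [pchar k] =i pred0)
    (g : vectType k) (br : {bilinear g -> g -> g})
    (br_lie : is_lie_bracket br)
    (novikov : exists dot : {bilinear g -> g -> g}, is_novikov_structure br dot) :
  lie_solvable br.
Proof. by case: novikov => dot; apply: novikov_lie_solvable. Qed.
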